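(* Consider smooth fields on a neighborhood of the origin in $\mathbb{R}^3$ describing a steady state of one fluid species in a rotationally symmetric two-dimensional problem: number density $n$, fluid velocity $\mathbf{u}$, symmetric positive definite temperature tensor $\mathsf{T}$, pressure tensor $P=n\mathsf{T}$, symmetric third-order heat flux tensor $\mathsf{q}$, magnetic field $\mathbf{B}$, a scalar $\tau>0$ (relaxation period), and a fourth-order tensor field $G$ of (gyrotropic) coefficients mapping symmetric traceless tensors to symmetric traceless tensors. Let $\kappa$ be a real constant (the charge-to-mass ratio). Assume that in a neighborhood of the origin the steady ten-moment temperature tensor evolution equation $$n\,(\mathbf{u}\cdot\nabla)\mathsf{T}+\mathrm{Sym2}(P\cdot\nabla\mathbf{u})+\nabla\cdot\mathsf{q}=\kappa\,\mathrm{Sym2}(P\times\mathbf{B})+\mathsf{R}$$ and the steady continuity equation $\nabla\cdot(n\mathbf{u})=0$ hold, with the isotropization closure $$\mathsf{R}/n=-\tau^{-1}\,G:\mathsf{T}^\circ,$$ where at each point the coefficients satisfy $$-(\Theta^{-1})^\circ:G:\Theta^\circ>0\quad\text{for every symmetric positive definite second-order tensor }\Theta\text{ with }\Theta^\circ\neq0.$$ Suppose that $n\neq0$ at the origin and that $\nabla\cdot\mathsf{q}$, $\nabla(\nabla\cdot\mathsf{q})$ and $\nabla^2(\nabla\cdot\mathsf{q})$ all vanish at the origin. Then $\nabla\cdot P=0$ at the origin.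
   Context: Coordinates are $(x,y,z)$. A problem is two-dimensional if all fields are independent of $z$ ($\partial_z=0$). It is rotationally symmetric if it is invariant under $180^\circ$ rotation about the $z$-axis: every component of every tensor field with an odd number of indices in $\{x,y\}$ is an odd function under $(x,y)\mapsto(-x,-y)$, and every component with an even number of such indices is an even function (scalars are even). Notation: for a symmetric second-order tensor $A$, $A^\circ=A-\tfrac13(\mathrm{tr}A)I$ is its deviatoric (traceless) part; $\mathrm{Sym2}(X)=X+X^T$; $(P\cdot\nabla\mathbf{u})_{ij}=\sum_kP_{ik}\partial_ku_j$; $(P\times\mathbf{B})_{ij}=\sum_{k,l}\epsilon_{jkl}P_{ik}B_l$; $(\nabla\cdot\mathsf{q})_{ij}=\sum_k\partial_k\mathsf{q}_{kij}$; $(\nabla\cdot P)_j=\sum_i\partial_iP_{ij}$; $(G:A)_{ij}=\sum_{kl}G_{ijkl}A_{kl}$; $A:G:B=\sum_{ijkl}A_{ij}G_{ijkl}B_{kl}$; $\nabla^2$ is the Laplacian (applied componentwise). ''Gyrotropic'' means invariant under rotations about the direction of the magnetic field. *)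

(* Defs.v *)
From HB Require Import structures.
From mathcomp Require Export all_boot all_order all_algebra.
From mathcomp Require Export all_classical all_reals all_analysis.

Set Implicit Arguments.
Unset Strict Implicit.
Unset Printing Implicit Defensive.

Import Order.TTheory GRing.Theory Num.Theory.
Import numFieldNormedType.Exports.

Local Open Scope classical_set_scope.
Local Open Scope ring_scope.

(* Points of space are row vectors; the coordinates x, y, z are the components
   with index 0, 1, 2.  Total functions stand for fields defined on an open
   set U; their values outside U are never constrained. *)

Section Fields.
Variable R : realType.

Local Notation space := 'rV[R]_3.
Local Notation tensor3 := ('I_3 -> 'I_3 -> 'I_3 -> R).
Local Notation tensor4 := ('I_3 -> 'I_3 -> 'I_3 -> 'I_3 -> R).

Definition z_index : 'I_3 := ord_max.

Definition partial (i : 'I_3) (f : space -> R) (x : space) : R :=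
  'D_(delta_mx 0 i) f x.

Definition laplacian (f : space -> R) (x : space) : R :=
  \sum_(k < 3) partial k (partial k f) x.

Fixpoint Ck_on (k : nat) (U : set space) (f : space -> R) : Prop :=
  (forall x, U x -> {for x, continuous f}) /\
  (if k is k'.+1 then
     (forall i x, U x -> derivable f x (delta_mx 0 i)) /\
     (forall i, Ck_on k' U (partial i f))
   else True).

Definition smooth_on (U : set space) (f : space -> R) : Prop :=
  forall k, Ck_on k U f.

Definition z_independent_on (U : set space) (f : space -> R) : Prop :=
  forall x, U x -> partial z_index f x = 0.

Definition is_xy (i : 'I_3) : bool := i != z_index.

Definition rotz180 (x : space) : space :=
  \row_i (if is_xy i then - x 0 i else x 0 i).

(* f is the component with index list s of a tensor field *)
Definition rot_symmetric_on (U : set space) (s : seq 'I_3) (f : space -> R) :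
    Prop :=
  forall x, U x -> U (rotz180 x) ->
    f (rotz180 x) = if odd (count is_xy s) then - f x else f x.

Definition admissible_on (U : set space) (s : seq 'I_3) (f : space -> R) :
    Prop :=
  [/\ smooth_on U f, z_independent_on U f & rot_symmetric_on U s f].

Definition sym_mx (A : 'M[R]_3) : Prop := A^T = A.

Definition spd_mx (A : 'M[R]_3) : Prop :=
  sym_mx A /\ forall v : 'rV[R]_3, v != 0 -> 0 < (v *m A *m v^T) 0 0.

Definition deviator (A : 'M[R]_3) : 'M[R]_3 := A - (\tr A / 3) *: 1%:M.

Definition Sym2 (X : 'M[R]_3) : 'M[R]_3 := X + X^T.

Definition levi_civita (i j k : 'I_3) : R :=
  let ijk := (val i, val j, val k) in
  (ijk \in [:: (0, 1, 2); (1, 2, 0); (2, 0, 1)]%N)%:R -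
  (ijk \in [:: (0, 2, 1); (2, 1, 0); (1, 0, 2)]%N)%:R.

Definition sym_tensor3 (t : tensor3) : Prop :=
  (forall i j k, t i j k = t j i k) /\ (forall i j k, t i j k = t i k j).

Definition apply4 (G : tensor4) (A : 'M[R]_3) : 'M[R]_3 :=
  \matrix_(i, j) \sum_(k < 3) \sum_(l < 3) G i j k l * A k l.

Definition contract4 (A : 'M[R]_3) (G : tensor4) (B : 'M[R]_3) : R :=
  \sum_(i < 3) \sum_(j < 3) \sum_(k < 3) \sum_(l < 3)
    A i j * G i j k l * B k l.

Definition preserves_sym_traceless (G : tensor4) : Prop :=
  forall A : 'M[R]_3, sym_mx A -> \tr A = 0 ->
    sym_mx (apply4 G A) /\ \tr (apply4 G A) = 0.

Definition rotation_about (b : 'rV[R]_3) (Q : 'M[R]_3) : Prop :=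
  [/\ Q *m Q^T = 1%:M, \det Q = 1 & b *m Q^T = b].

(* No condition where b = 0, since the field then has no direction. *)
Definition gyrotropic (b : 'rV[R]_3) (G : tensor4) : Prop :=
  b != 0 -> forall Q : 'M[R]_3, rotation_about b Q ->
    forall i j k l, G i j k l =
      \sum_(i' < 3) \sum_(j' < 3) \sum_(k' < 3) \sum_(l' < 3)
        Q i i' * Q j j' * Q k k' * Q l l' * G i' j' k' l'.

Definition entropy_respecting (G : tensor4) : Prop :=
  forall Theta : 'M[R]_3, spd_mx Theta -> deviator Theta != 0 ->
    0 < - contract4 (deviator (invmx Theta)) G (deviator Theta).

Definition div_vec (v : space -> 'rV[R]_3) (x : space) : R :=
  \sum_(i < 3) partial i (fun y => v y 0 i) x.

Definition div_mx (A : space -> 'M[R]_3) (x : space) : 'rV[R]_3 :=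
  \row_j \sum_(i < 3) partial i (fun y => A y i j) x.

Definition div_tensor3 (q : space -> tensor3) (x : space) : 'M[R]_3 :=
  \matrix_(i, j) \sum_(k < 3) partial k (fun y => q y k i j) x.

(* (u . nabla) T *)
Definition advect (u : space -> 'rV[R]_3) (T : space -> 'M[R]_3) (x : space) :
    'M[R]_3 :=
  \matrix_(i, j) \sum_(k < 3) u x 0 k * partial k (fun y => T y i j) x.

(* P . nabla u *)
Definition mx_dot_grad (P : space -> 'M[R]_3) (u : space -> 'rV[R]_3)
    (x : space) : 'M[R]_3 :=
  \matrix_(i, j) \sum_(k < 3) P x i k * partial k (fun y => u y 0 j) x.

(* P x B *)
Definition mx_cross (P : 'M[R]_3) (b : 'rV[R]_3) : 'M[R]_3 :=
  \matrix_(i, j) \sum_(k < 3) \sum_(l < 3)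
    levi_civita j k l * P i k * b 0 l.

Definition pressure (n : space -> R) (T : space -> 'M[R]_3) (x : space) :
    'M[R]_3 := n x *: T x.

End Fields.

(* Main.v *)
Require Import Defs.
From mathcomp Require Import ring lra.
Import Order.TTheory GRing.Theory Num.Theory.
Import numFieldNormedType.Exports.
Local Open Scope classical_set_scope.
Local Open Scope ring_scope.

Set Implicit Arguments.
Unset Strict Implicit.
Unset Printing Implicit Defensive.

(** At the origin, contracting the temperature equation with the inverse of
    [T] leaves only the entropy production of the relaxation, so [T] is
    isotropic there and the velocity gradient [V] is antisymmetric. Write [D
    k] for the derivatives of [T] and [W k] for those of [V] at the origin.
    The Laplacian of the trace of the equation, with the Laplacian of the
    continuity equation, reduces to [\sum_k \tr (D k *m W k) = 0].
    Differentiating the equation once and contracting with [D k], every term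
    but the relaxation one is this sum or an antisymmetric tensor against a
    symmetric one, so [\sum_k D k : G : D k = 0]. By parity [D k] only has xz
    and yz components, and on such tensors the entropy condition at [1 + c D]
    makes [D : G : D] positive definite; thus [T] has zero gradient, and so
    has the pressure. *)

(** * Calculus of iterated partial derivatives on an open set *)

Section PartialDerivatives.
Variable R : realType.
Implicit Types (f g : 'rV[R]_3 -> R) (x : 'rV[R]_3) (U : set 'rV[R]_3).

Lemma near_eq_partial f g x i :
  (\forall y \near x, f y = g y) -> partial i f x = partial i g x.
Proof. exact: near_eq_derive. Qed.

Lemma near_eq_partial2 f g x i j :
  (\forall y \near x, f y = g y) ->
  partial i (partial j f) x = partial i (partial j g) x.
Proof.
move=> fg; apply: near_eq_partial.
apply: filterS (nbhs_interior fg) => y.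
by move=> ?; exact: near_eq_partial.
Qed.

Lemma near_open U x : open U -> U x -> \forall y \near x, U y.
Proof. by move=> oU Ux; apply: open_nbhs_nbhs; split. Qed.

Lemma near_eq_continuous f g x : (\forall y \near x, f y = g y) ->
  {for x, continuous f} -> {for x, continuous g}.
Proof.
move=> fg cf; rewrite /prop_for /continuous_at -(nbhs_singleton fg).
exact: cvg_trans (@near_eq_cvg _ _ (nbhs x) _ f g fg) cf.
Qed.

(** On an open set, equality on [U] holds near each point and therefore survives differentiation.
    This lets the sum and product rules, valid only on [U], be substituted inside [Ck_on]. *)
Lemma Ck_on_eq U f g k : open U -> (forall x, U x -> f x = g x) ->
  Ck_on k U f -> Ck_on k U g.
Proof.
move=> oU; elim: k f g => [|k IH] f g fg.
all: have nfg x : U x -> \forall y \near x, f y = g y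
  by move=> Ux; near=> y; apply: fg; near: y; exact: near_open.
  by move=> [cf _]; split=> // x Ux;
    exact: near_eq_continuous (nfg x Ux) (cf x Ux).
move=> [cf [df pf]]; split; last split.
- by move=> x Ux; exact: near_eq_continuous (nfg x Ux) (cf x Ux).
- by move=> i x Ux; apply: near_eq_derivable (df i x Ux); exact: nfg.
- by move=> i; apply: IH (pf i) => x Ux; apply: near_eq_partial; exact: nfg.
Unshelve. all: by end_near. Qed.

Lemma smooth_on_continuous U f x : smooth_on U f -> U x ->
  {for x, continuous f}.
Proof. by move=> /(_ 0%N) [cf _]; exact: cf. Qed.

Lemma smooth_on_derivable U f x i : smooth_on U f -> U x ->
  derivable f x (delta_mx 0 i).
Proof. by move=> /(_ 1%N) [_ [df _]]; exact: df. Qed.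

Lemma smooth_on_partial U f i : smooth_on U f -> smooth_on U (partial i f).
Proof. by move=> sf k; have [_ [_ pf]] := sf k.+1; exact: pf. Qed.

Lemma Ck_onS U f k : Ck_on k.+1 U f -> Ck_on k U f.
Proof.
elim: k f => [|k IH] f [cf [df pf]]; first by split.
by split=> //; split=> // i; exact: (IH _ (pf i)).
Qed.

Lemma partial_cst (c : R) i : partial i (fun=> c) = (fun=> 0).
Proof. by apply/funext => x; exact: derive_cst. Qed.

Lemma smooth_on_cst U (c : R) : smooth_on U (fun=> c).
Proof.
move=> k; elim: k c => [|k IH] c; first by split=> // x _;
  exact: cst_continuous.
split=> [x _|]; first exact: cst_continuous.
by split=> [i x _|i]; [exact: derivable_cst|rewrite partial_cst].
Qed.

Lemma partialD U f g x i : smooth_on U f -> smooth_on U g -> U x ->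
  partial i (fun y => f y + g y) x = partial i f x + partial i g x.
Proof.
by move=> sf sg Ux; apply: deriveD; exact: smooth_on_derivable Ux.
Qed.

Lemma partialM U f g x i : smooth_on U f -> smooth_on U g -> U x ->
  partial i (fun y => f y * g y) x = partial i f x * g x + f x * partial i g x.
Proof.
move=> sf sg Ux; rewrite addrC [partial i f x * _]mulrC.
by apply: deriveM; exact: smooth_on_derivable Ux.
Qed.

Lemma Ck_onD U f g k : open U -> Ck_on k U f -> Ck_on k U g ->
  Ck_on k U (fun x => f x + g x).
Proof.
move=> oU; elim: k f g => [|k IH] f g [cf fP] [cg gP].
  by split=> // x Ux; exact: (continuousD (cf x Ux) (cg x Ux)).
move: fP gP => [df pf] [dg pg]; split; last split.
- by move=> x Ux; exact: (continuousD (cf x Ux) (cg x Ux)).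
- by move=> i x Ux; apply: derivableD; [exact: df|exact: dg].
- move=> i; apply: Ck_on_eq (IH _ _ (pf i) (pg i)) => // x Ux.
  by rewrite /partial; apply/esym/deriveD; [exact: df|exact: dg].
Qed.

Lemma Ck_onM U f g k : open U -> Ck_on k U f -> Ck_on k U g ->
  Ck_on k U (fun x => f x * g x).
Proof.
move=> oU; elim: k f g => [|k IH] f g kf kg.
  case: kf kg => [cf fP] [cg gP].
  by split=> // x Ux; exact: (continuousM (cf x Ux) (cg x Ux)).
have [[cf [df pf]] [cg [dg pg]]] := (kf, kg); split; last split.
- by move=> x Ux; exact: (continuousM (cf x Ux) (cg x Ux)).
- by move=> i x Ux; apply: derivableM; [exact: df|exact: dg].
(* The Leibniz rule pairs a partial of one factor with the other factor undifferentiated, whose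
   order [Ck_onS] lowers to [k]. *)
- move=> i; have h1 := IH _ _ (Ck_onS kf) (pg i).
  have h2 := IH _ _ (Ck_onS kg) (pf i).
  apply: Ck_on_eq (Ck_onD oU h1 h2) => // x Ux.
  by rewrite /partial; apply/esym/deriveM; [exact: df|exact: dg].
Qed.

Lemma smooth_onD U f g : open U -> smooth_on U f -> smooth_on U g ->
  smooth_on U (fun x => f x + g x).
Proof. by move=> oU sf sg k; exact: Ck_onD. Qed.

Lemma smooth_onM U f g : open U -> smooth_on U f -> smooth_on U g ->
  smooth_on U (fun x => f x * g x).
Proof. by move=> oU sf sg k; exact: Ck_onM. Qed.

Lemma smooth_on_sum U (I : finType) (h : I -> 'rV[R]_3 -> R) : open U ->
  (forall i, smooth_on U (h i)) -> smooth_on U (fun x => \sum_i h i x).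
Proof.
move=> oU sh; elim: (index_enum I) => [|i s IH].
  by under eq_fun do rewrite big_nil; exact: smooth_on_cst.
by under eq_fun do rewrite big_cons; exact: smooth_onD.
Qed.

Lemma partial_sum U (I : finType) (h : I -> 'rV[R]_3 -> R) x i : open U ->
  (forall j, smooth_on U (h j)) -> U x ->
  partial i (fun y => \sum_j h j y) x = \sum_j partial i (h j) x.
Proof.
move=> oU sh Ux.
have aux s : smooth_on U (fun y => \sum_(j <- s) h j y) /\
  partial i (fun y => \sum_(j <- s) h j y) x = \sum_(j <- s) partial i (h j) x.
  elim: s => [|j s [sm IH]].
    under eq_fun do rewrite big_nil; rewrite big_nil.
    by split; [exact: smooth_on_cst|exact: derive_cst].
  under eq_fun do rewrite big_cons; rewrite big_cons.
  by split; [exact: smooth_onD|rewrite (partialD _ _ sm Ux)// IH].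
exact: (aux _).2.
Qed.

Lemma partialZ U (c : R) f x i : smooth_on U f -> U x ->
  partial i (fun y => c * f y) x = c * partial i f x.
Proof.
move=> sf Ux; rewrite (partialM _ (smooth_on_cst _ _) sf Ux).
by rewrite partial_cst mul0r add0r.
Qed.

Lemma partial2D U f g x i j : open U -> smooth_on U f -> smooth_on U g -> U x ->
  partial i (partial j (fun y => f y + g y)) x =
  partial i (partial j f) x + partial i (partial j g) x.
Proof.
move=> oU sf sg Ux; rewrite -(partialD _ (smooth_on_partial _ sf) _ Ux);
  last exact: smooth_on_partial.
apply: near_eq_partial; near=> y; have Uy : U y by near: y; exact: near_open.
exact: partialD Uy.
Unshelve. all: by end_near. Qed.

Lemma partial2M U f g x i : open U -> smooth_on U f -> smooth_on U g -> U x ->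
  partial i (partial i (fun y => f y * g y)) x =
  partial i (partial i f) x * g x + 2 * (partial i f x * partial i g x)
  + f x * partial i (partial i g) x.
Proof.
move=> oU sf sg Ux.
have [spf spg] := (smooth_on_partial i sf, smooth_on_partial i sg).
(* The first-order rule holds throughout a neighborhood of [x], so its right-hand side may be
   differentiated in turn. *)
rewrite (@near_eq_partial _
  (fun y => partial i f y * g y + f y * partial i g y)).
  rewrite (partialD _ (smooth_onM oU spf sg) (smooth_onM oU sf spg) Ux).
  rewrite (partialM _ spf sg Ux) (partialM _ sf spg Ux).
  by rewrite mulr_natl mulr2n !addrA.
near=> y; have Uy : U y by near: y; exact: near_open.
exact: partialM Uy.
Unshelve. all: by end_near. Qed.

Lemma partial2_sum U (I : finType) (h : I -> 'rV[R]_3 -> R) x i j : open U ->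
  (forall l, smooth_on U (h l)) -> U x ->
  partial i (partial j (fun y => \sum_l h l y)) x =
  \sum_l partial i (partial j (h l)) x.
Proof.
move=> oU sh Ux.
rewrite -(partial_sum _ oU (fun l => smooth_on_partial j (sh l)) Ux).
apply: near_eq_partial; near=> y; have Uy : U y by near: y; exact: near_open.
exact: partial_sum Uy.
Unshelve. all: by end_near. Qed.

End PartialDerivatives.

(** * Symmetry of mixed second partial derivatives *)

Section Schwarz.
Variable R : realType.
Implicit Types (f g : 'rV[R]_3 -> R) (x : 'rV[R]_3) (U : set 'rV[R]_3).

(** Both derivatives are limits of the same difference quotient; this brings one-variable calculus
    to lines in space. *)
Lemma is_derive_line f x v (s : R) : derivable f (s *: v + x) v ->
  is_derive s 1 (fun t => f (t *: v + x)) ('D_v f (s *: v + x)).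
Proof.
have E : (fun h : R => h^-1 *: (((fun t : R => f (t *: v + x)) \o shift s) (h *: 1)
    - f (s *: v + x))) =
  (fun h => h^-1 *: ((f \o shift (s *: v + x)) (h *: v) - f (s *: v + x))).
  apply/funext => h /=; congr (_ *: (f _ - _)).
  by rewrite [h%:A]mulr1 scalerDl addrA.
by move=> df; split; rewrite /derivable /derive E.
Qed.

Lemma MVT_line f x v (h : R) : 0 < h ->
  (forall s, 0 <= s <= h -> derivable f (s *: v + x) v) ->
  exists2 s, 0 <= s <= h & f (h *: v + x) - f x = 'D_v f (s *: v + x) * h.
Proof.
move=> h0 df.
have dl s : s \in `[0, h] -> is_derive s 1 (fun t => f (t *: v + x))
    ('D_v f (s *: v + x)).
  by rewrite in_itv /= => s0h; apply/is_derive_line/df.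
have dlo s : s \in `]0, h[ -> is_derive s 1 (fun t => f (t *: v + x))
    ('D_v f (s *: v + x)).
  by move=> s0h; apply: dl; move: s0h; rewrite !in_itv /= => /andP[? ?];
    rewrite !ltW.
have cl : {within `[0, h], continuous (fun t => f (t *: v + x))}.
  by apply: derivable_within_continuous => s /dl [].
have [s s0h] := MVT h0 dlo cl.
rewrite scale0r add0r subr0 => ->; exists s => //.
by move: s0h; rewrite in_itv /= => /andP[s0 sh]; rewrite !ltW.
Qed.

(** The mean value theorem is applied twice: along axis [i] to the increment [g] of [f] in direction
    [j], then along axis [j] to [partial i f]. *)
Lemma second_difference U f x i j (h : R) : smooth_on U f -> 0 < h ->
  (forall s t, 0 <= s <= h -> 0 <= t <= h ->
     U (s *: delta_mx 0 i + t *: delta_mx 0 j + x)) ->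
  exists s t, [/\ 0 <= s <= h, 0 <= t <= h &
    f (h *: delta_mx 0 i + h *: delta_mx 0 j + x) - f (h *: delta_mx 0 i + x)
      - f (h *: delta_mx 0 j + x) + f x =
    partial j (partial i f) (s *: delta_mx 0 i + t *: delta_mx 0 j + x) * h ^+
      2].
Proof.
set a := delta_mx 0 i; set b := delta_mx 0 j => sf h0 Ubox.
have hh : 0 <= h <= h by rewrite lexx ltW.
have h0h : 0 <= (0 : R) <= h by rewrite lexx ltW.
pose g y := f (h *: b + y) - f y.
have dg s : 0 <= s <= h -> is_derive (s *: a + x) a g
    (partial i f (h *: b + (s *: a + x)) - partial i f (s *: a + x)).
  move=> s0h; apply: is_deriveB.
    have d1 : derivable f (h *: b + (s *: a + x)) a.
      apply: smooth_on_derivable sf _.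
      by rewrite addrA [_ *: b + _]addrC; exact: Ubox.
    have E : (fun k : R => k^-1 *: (((fun y => f (h *: b + y)) \o shift (s *: a + x))
      (k *: a) - f (h *: b + (s *: a + x)))) = (fun k => k^-1 *: ((f \o
      shift (h *: b + (s *: a + x))) (k *: a) - f (h *: b + (s *: a + x)))).
      by apply/funext => k /=; congr (_ *: (f _ - _)); rewrite addrCA.
    by split; rewrite /partial /derivable /derive E.
  apply: derivableP; apply: smooth_on_derivable sf _.
  by have := Ubox s 0 s0h h0h; rewrite scale0r addr0.
have [s s0h Es] := @MVT_line g x a h h0 (fun s s0h => @ex_derive _ _ _ _ _ _ _
  (dg s s0h)).
have [t t0h Et] : exists2 t, 0 <= t <= h &
    partial i f (h *: b + (s *: a + x)) - partial i f (s *: a + x) =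
    partial j (partial i f) (t *: b + (s *: a + x)) * h.
  apply: MVT_line h0 _ => t t0h.
  apply: smooth_on_derivable (smooth_on_partial i sf) _.
  by rewrite addrA [_ *: b + _]addrC; exact: Ubox.
exists s, t; split=> //.
have -> : s *: a + t *: b + x = t *: b + (s *: a + x) by rewrite addrA [t *: b
  + _]addrC.
rewrite expr2 mulrA -Et -(@derive_val _ _ _ _ _ _ _ (dg s s0h)) -Es /g.
by rewrite addrA [h *: b + h *: a]addrC; ring.
Qed.

Lemma dist_le_close (e p q c d : R) : c = d ->
  `|p - c| < e / 2 -> `|q - d| < e / 2 -> `|q - p| <= e.
Proof.
move=> ->; rewrite !ltr_norml ler_norml => /andP[? ?] /andP[? ?].
by apply/andP; split; lra.
Qed.

(** The second difference of [f] over a small box is symmetric in [i] and [j]. Hence the two mixed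
    partials share a value, each at some point of the box, and continuity at [x] makes them
    arbitrarily close there. *)
Lemma partialC U f x i j : open U -> smooth_on U f -> U x ->
  partial i (partial j f) x = partial j (partial i f) x.
Proof.
move=> oU sf Ux; apply/eqP; rewrite -subr_eq0 -normr_le0;
  apply/ler_addgt0Pl => e e0.
rewrite addr0.
have cts k l : \forall y \near x,
    `|partial k (partial l f) x - partial k (partial l f) y| < e / 2.
  have /cvgr_dist_lt := smooth_on_continuous
    (smooth_on_partial k (smooth_on_partial l sf)) Ux.
  by apply; rewrite divr_gt0.
have : \forall y \near x, [/\ U y,
    `|partial i (partial j f) x - partial i (partial j f) y| < e / 2 &
    `|partial j (partial i f) x - partial j (partial i f) y| < e / 2].
  apply: filterS3 (near_open oU Ux) (cts i j) (cts j i) => y; exact: And3.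
move=> /nbhs_ballP[r /= r0 rP].
set a : 'rV[R]_3 := delta_mx 0 i; set b : 'rV[R]_3 := delta_mx 0 j.
have N0 : 0 < 1 + `|a| + `|b| by rewrite -addrA ltr_pwDl// addr_ge0.
(* Here [h * (|a| + |b|) = r - h < r], so the box stays inside the open ball. *)
pose h := r / (1 + `|a| + `|b|).
have h0 : 0 < h by rewrite divr_gt0.
have box s t : 0 <= s <= h -> 0 <= t <= h -> ball x r (s *: a + t *: b + x).
  move=> /andP[s0 sh] /andP[t0 th];
    rewrite -ball_normE /= opprD addrCA subrr addr0.
  rewrite normrN; apply: le_lt_trans (ler_normD _ _) _.
  rewrite !normrZ !ger0_norm//.
  have : s * `|a| + t * `|b| <= h * `|a| + h * `|b|.
    by apply: lerD; apply: ler_wpM2r.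
  have : h * (1 + `|a| + `|b|) = r by rewrite /h divfK// gt_eqF.
  by nra.
have [s [t [s0 t0 E1]]] := @second_difference U f x i j h sf h0
  (fun s t s0 t0 => let: And3 Uy _ _ := rP _ (box s t s0 t0) in Uy).
have [t' [s' [t'0 s'0 E2]]] : exists s t, [/\ 0 <= s <= h, 0 <= t <= h &
    f (h *: b + h *: a + x) - f (h *: b + x) - f (h *: a + x) + f x =
    partial i (partial j f) (s *: b + t *: a + x) * h ^+ 2].
  apply: second_difference sf h0 _ => s1 t1 s10 t10.
  by rewrite [s1 *: _ + _]addrC; have [] := rP _ (box _ _ t10 s10).
(* The two second differences differ only in the order of their terms; dividing by [h ^+ 2] equates
   the mixed partials at two possibly different points. *)
have E : partial j (partial i f) (s *: a + t *: b + x) =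
         partial i (partial j f) (s' *: a + t' *: b + x).
  apply: (@mulIf _ (h ^+ 2)); first by rewrite expf_neq0// gt_eqF.
  apply: etrans (esym E1) _; rewrite (addrC (s' *: a)); apply: etrans _ E2.
  by rewrite (addrC (h *: b) (h *: a)); congr (_ + _); exact: addrAC.
have [_ _ H1] := rP _ (box _ _ s0 t0).
have [_ H2 _] := rP _ (box _ _ s'0 t'0).
exact: dist_le_close E H1 H2.
Qed.

End Schwarz.

(** * Parity of field components at the origin *)

Section RotationalSymmetry.
Variables (R : realType) (U : set 'rV[R]_3).
Hypotheses (openU : open U) (U0 : U 0).
Implicit Types (f : 'rV[R]_3 -> R) (s : seq 'I_3).

(** The rotation fixes the origin, so such a component equals its own negative there. *)
Lemma odd_component_at0 s f : admissible_on U s f -> odd (count is_xy s) ->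
  f 0 = 0.
Proof.
move=> [_ _ sym] os; have r0 : rotz180 0 = 0 :> 'rV[R]_3.
  by apply/rowP => i; rewrite !mxE oppr0 if_same.
have := sym 0 U0; rewrite r0 os => /(_ U0) => ?; lra.
Qed.

(** Along z this is [z_independent_on]. Along a horizontal axis the rotation acts as [t -> -t], so
    the restriction of [f] is even and its derivative at [0] equals its own negative. *)
Lemma even_component_partial0 s f k : admissible_on U s f ->
  ~~ odd (count is_xy s) -> partial k f 0 = 0.
Proof.
move=> [sf zf sym] /negbTE os; have [->|kz] := eqVneq k z_index;
  first exact: zf.
set v : 'rV[R]_3 := delta_mx 0 k; pose g t := f (t *: v + 0).
have dg : is_derive (0 : R) 1 g (partial k f 0).
  have := @is_derive_line R f 0 v 0; rewrite scale0r add0r; apply.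
  exact: smooth_on_derivable sf U0.
have rot t : rotz180 (t *: v) = - (t *: v).
  apply/rowP => i; rewrite !mxE /is_xy; case: ifPn => // /negPn/eqP ->.
  by rewrite eqxx /= eq_sym (negbTE kz) mulr0 oppr0.
(* The symmetry is available only where both a point and its image lie in [U]. *)
have UN : \forall x \near (0 : 'rV[R]_3), U x /\ U (- x).
  apply: filterI; first exact: near_open.
  by apply: (@oppr_continuous _ _ (0 : 'rV[R]_3)); rewrite oppr0;
    exact: near_open.
have ge : \forall t \near (0 : R), g t = (g \o -%R) t.
  have := near0Z v UN; apply: filterS => t [Ut UNt].
  rewrite /g /= scaleNr !addr0 -rot.
  by rewrite sym ?rot// os.
have dgN : is_derive (0 : R) 1 (g \o -%R) (- partial k f 0).
  have dN : is_derive (0 : R) (1 : R) -%R (-1 : R) by exact: is_deriveNid.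
  have dg' : is_derive (- (0 : R)) 1 g (partial k f 0) by rewrite oppr0.
  by have := is_derive1_comp dg' dN; rewrite /GRing.scale /= mulrN1.
have := @near_eq_derive _ _ _ g (g \o -%R) 0 1 ge;
  rewrite (@derive_val _ _ _ _ _ _ _ dg).
rewrite (@derive_val _ _ _ _ _ _ _ dgN) => ?; lra.
Qed.

End RotationalSymmetry.

(** * Algebra of 3 by 3 matrices and fourth-order tensors *)

Section TensorAlgebra.
Variable R : realType.
Implicit Types (A B D T X Y : 'M[R]_3) (G : 'I_3 -> 'I_3 -> 'I_3 -> 'I_3 -> R).

Lemma sum_ord3 (V : nmodType) (F : 'I_3 -> V) :
  \sum_(i < 3) F i = F 0 + F 1 + F z_index.
Proof.
rewrite !big_ord_recr big_ord0 /= add0r.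
by congr (F _ + F _ + F _); exact: val_inj.
Qed.

Lemma ord3_ind (P : 'I_3 -> Prop) : P 0 -> P 1 -> P z_index -> forall i, P i.
Proof.
move=> P0 P1 P2 [[|[|[|//]]] lti].
- by rewrite (_ : Ordinal _ = 0)//; exact: val_inj.
- by rewrite (_ : Ordinal _ = 1)//; exact: val_inj.
- by rewrite (_ : Ordinal _ = z_index)//; exact: val_inj.
Qed.

(** Transposition preserves the trace, yet it turns [A *m B] into [- (B *m A)], whose trace is the
    opposite one by cyclicity. *)
Lemma mxtrace_sym_antisym A B : sym_mx A -> B^T = - B -> \tr (A *m B) = 0.
Proof.
move=> sA aB; have := mxtrace_tr (A *m B).
by rewrite trmx_mul sA aB mulNmx raddfN mxtrace_mulC /= => ?; lra.
Qed.

Lemma mxtrace_antisym B : B^T = - B -> \tr B = 0.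
Proof.
by move=> aB; rewrite -[B]mul1mx mxtrace_sym_antisym// /sym_mx trmx1.
Qed.

Lemma mxtrace_Sym2 A X : sym_mx A -> \tr (A *m Sym2 X) = \tr (A *m X) *+ 2.
Proof.
move=> sA; rewrite /Sym2 mulmxDr mxtraceD mulr2n; congr (_ + _).
by rewrite -mxtrace_tr trmx_mul trmxK sA mxtrace_mulC.
Qed.

Lemma Sym2_antisym B : B^T = - B -> Sym2 B = 0.
Proof. by move=> aB; rewrite /Sym2 aB subrr. Qed.

Lemma Sym2D X Y : Sym2 (X + Y) = Sym2 X + Sym2 Y.
Proof. by rewrite /Sym2 linearD /= addrACA. Qed.

Lemma Sym2Z (c : R) X : Sym2 (c *: X) = c *: Sym2 X.
Proof. by rewrite /Sym2 linearZ /= scalerDr. Qed.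

Lemma Sym2B X Y : Sym2 (X - Y) = Sym2 X - Sym2 Y.
Proof. by rewrite -scaleN1r Sym2D Sym2Z scaleN1r. Qed.

Lemma sym_mxZ (c : R) A : sym_mx A -> sym_mx (c *: A).
Proof. by rewrite /sym_mx linearZ /= => ->. Qed.

Lemma sym_mx_deviator A : sym_mx A -> sym_mx (deviator A).
Proof.
by rewrite /sym_mx /deviator linearB /= linearZ /= trmx1 => ->.
Qed.

Lemma mxtrace_deviator A : \tr (deviator A) = 0.
Proof.
rewrite /deviator linearB /= linearZ /= mxtrace1 /GRing.scale /=.
by field.
Qed.

Lemma deviator0_scalar A : deviator A = 0 -> A = (\tr A / 3) *: 1%:M.
Proof. by move/eqP; rewrite subr_eq0 => /eqP. Qed.

Lemma contract4E A G B : contract4 A G B = \tr (A^T *m apply4 G B).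
Proof.
rewrite /contract4 /mxtrace exchange_big /=; apply: eq_bigr => j _.
rewrite !mxE; apply: eq_bigr => i _; rewrite !mxE mulr_sumr.
apply: eq_bigr => k _; rewrite mulr_sumr; apply: eq_bigr => l _.
by rewrite mulrA.
Qed.

Lemma spd_mx_unit A : spd_mx A -> A \in unitmx.
Proof.
move=> [_ pA]; rewrite unitmxE unitfE; apply/negP => /det0P[v v0 vA].
by have := pA v v0; rewrite vA mul0mx mxE ltxx.
Qed.

(* Contraction with [T^-1] turns the right-hand side into [2 \tr X] and the
   left-hand side into a nonzero multiple of the entropy production. *)
Lemma entropy_equilibrium G T X (c : R) : spd_mx T ->
  preserves_sym_traceless G -> entropy_respecting G -> c != 0 -> \tr X = 0 ->
  c *: apply4 G (deviator T) = Sym2 (T *m X) -> deviator T = 0.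
Proof.
move=> pT sG pG c0 X0 E; apply/eqP/negPn/negP => dT.
have := pG _ pT dT; suff -> : contract4 (deviator (invmx T)) G (deviator T) = 0.
  by rewrite oppr0 ltxx.
have [sT _] := pT; have uT := spd_mx_unit pT.
have sI : sym_mx (invmx T) by rewrite /sym_mx trmx_inv sT.
rewrite contract4E (sym_mx_deviator sI) {1}/deviator mulmxBl linearB /=.
have [_ tr0] := sG _ (sym_mx_deviator sT) (mxtrace_deviator T).
rewrite -scalemxAl mul1mx linearZ /= tr0 mulr0 subr0.
apply: (mulfI c0); rewrite mulr0 -mxtraceZ scalemxAr E.
by rewrite mxtrace_Sym2// mulKmx// X0 mul0rn.
Qed.

Lemma apply4Z G (c : R) B : apply4 G (c *: B) = c *: apply4 G B.
Proof.
apply/matrixP => i j; rewrite !mxE mulr_sumr; apply: eq_bigr => k _.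
by rewrite mulr_sumr; apply: eq_bigr => l _; rewrite mxE mulrCA.
Qed.

(** In a term where [A] and [D] are both nonzero, the first two indices agree in parity and the last
    two do not, so that component of [G] is odd. *)
Lemma contract4_parity A G D :
  (forall i j, is_xy i != is_xy j -> A i j = 0) ->
  (forall i j, is_xy i = is_xy j -> D i j = 0) ->
  (forall i j k l, is_xy i (+) is_xy j (+) is_xy k (+) is_xy l ->
    G i j k l = 0) -> contract4 A G D = 0.
Proof.
move=> evA oddD evG; rewrite /contract4.
do 4![apply: big1 => ? _]; set i := (X in A X _); set j := (X in A i X).
set k := (X in D X _); set l := (X in D k X).
have [xij|xij] := eqVneq (is_xy i) (is_xy j); last by rewrite evA ?mul0r.
have [xkl|xkl] := eqVneq (is_xy k) (is_xy l); first by rewrite oddD ?mulr0.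
rewrite evG ?mulr0 ?mul0r// xij addbb.
by case: (is_xy k) (is_xy l) xkl => [] [].
Qed.

(* With [Theta = 1 + c D] the cubic relation [D^3 = s D] gives
   [Theta^-1 = 1 - c/(1 - c^2 s) D + c^2/(1 - c^2 s) D^2]; its last term is
   even, so parity leaves only the term quadratic in [D]. *)
Lemma contract4_odd_gt0 G D : entropy_respecting G -> sym_mx D ->
  (forall i j, is_xy i = is_xy j -> D i j = 0) ->
  (forall i j k l, is_xy i (+) is_xy j (+) is_xy k (+) is_xy l ->
    G i j k l = 0) -> D != 0 -> 0 < contract4 D G D.
Proof.
move=> pG sD oddD evG D0.
have symD i j : D i j = D j i by rewrite -[in LHS]sD mxE.
pose a := D 0 z_index; pose b := D 1 z_index; pose s := a ^+ 2 + b ^+ 2.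
have DE : [/\ D 0 0 = 0, D 0 1 = 0, D 1 0 = 0 & D 1 1 = 0].
  by split; apply: oddD.
have Dzz : D z_index z_index = 0 by apply: oddD.
case: DE => D00 D01 D10 D11.
have Dza : D z_index 0 = a by exact: symD.
have Dzb : D z_index 1 = b by exact: symD.
have s0 : 0 < s.
  rewrite lt_neqAle addr_ge0 ?sqr_ge0// andbT eq_sym paddr_eq0 ?sqr_ge0//.
  rewrite !sqrf_eq0; apply: contra D0 => /andP[/eqP a0 /eqP b0].
  apply/eqP/matrixP => i j; rewrite mxE.
  elim/ord3_ind: i; elim/ord3_ind: j => //; by rewrite ?Dza ?Dzb.
have cube : D *m D *m D = s *: D.
  apply/matrixP => i j; rewrite !mxE; rewrite !sum_ord3 !mxE !sum_ord3.
  elim/ord3_ind: i; elim/ord3_ind: j;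
    rewrite ?D00 ?D01 ?D10 ?D11 ?Dza ?Dzb ?Dzz /s /a /b; ring.
(* Any positive [c] with [c ^+ 2 * s < 1] would do; this one is rational in [s], and makes [m]
   positive because [s < (1 + s) ^+ 2]. *)
pose c := (1 + s)^-1.
have c0 : 0 < c by rewrite invr_gt0 ltr_wpDl// ltW.
have cs : c * (1 + s) = 1 by rewrite mulVf// gt_eqF// ltr_wpDl// ltW.
pose m := 1 - c ^+ 2 * s.
have m0 : 0 < m by rewrite /m; nra.
pose Th : 'M[R]_3 := 1%:M + c *: D.
pose N : 'M[R]_3 := 1%:M - (c / m) *: D + (c ^+ 2 / m) *: (D *m D).
have ThN : Th *m N = 1%:M.
  rewrite /Th /N mulmxDl mul1mx !mulmxDr mulmxN mulmx1 -!scalemxAl -!scalemxAr.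
  rewrite mulmxA cube !scalerA; apply/matrixP => i j; rewrite !mxE.
  by rewrite /m; field; rewrite -/m gt_eqF.
have invTh : invmx Th = N.
  have [uTh _] := mulmx1_unit ThN.
  by rewrite -[LHS]mulmx1 -ThN mulKmx.
have trD : \tr D = 0 by rewrite /mxtrace sum_ord3 D00 D11 Dzz !addr0.
have devTh : deviator Th = c *: D.
  rewrite /deviator /Th mxtraceD mxtraceZ trD mulr0 addr0 mxtrace1.
  by rewrite divff ?pnatr_eq0// scale1r addrC addKr.
have pTh : spd_mx Th.
  split; first by rewrite /sym_mx /Th linearD /= linearZ /= trmx1 sD.
  move=> v v0; rewrite /Th mulmxDr mulmx1 mulmxDl -scalemxAr -scalemxAl.
  rewrite !mxE !sum_ord3 !mxE !sum_ord3 D00 D01 D10 D11 Dza Dzb Dzz -/a -/b.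
  set x := v 0 0; set y := v 0 1; set z := v 0 z_index.
  have : 0 < x ^+ 2 + y ^+ 2 + z ^+ 2.
    rewrite lt_neqAle !addr_ge0 ?sqr_ge0// andbT eq_sym !paddr_eq0 ?addr_ge0
      ?sqr_ge0//.
    rewrite !sqrf_eq0;
      apply: contra v0 => /andP[/andP[/eqP x0 /eqP y0] /eqP z0].
    by apply/eqP/rowP => i; rewrite mxE; elim/ord3_ind: i.
  (* Completing the square in [z] and using [(a x + b y)^2 + (b x - a y)^2 = s (x^2 + y^2)] leaves
     squares with nonnegative coefficients. *)
  have -> : x * x + y * y + z * z + c * ((x * 0 + y * 0 + z * a) * x +
      (x * 0 + y * 0 + z * b) * y + (x * a + y * b + z * 0) * z) =
    (z + c * (a * x + b * y)) ^+ 2 + c ^+ 2 * (b * x - a * y) ^+ 2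
      + m * (x ^+ 2 + y ^+ 2) by rewrite /m /s; ring.
  have [xy|xy] := ltP 0 (x ^+ 2 + y ^+ 2).
    move=> _; rewrite ltr_wpDl ?mulr_gt0//.
    by rewrite addr_ge0 ?sqr_ge0// mulr_ge0 ?sqr_ge0.
  have x0 : x = 0 by nra.
  have y0 : y = 0 by nra.
  by rewrite x0 y0 => z0; nra.
have := pG _ pTh; rewrite devTh scaler_eq0 negb_or gt_eqF// D0 => /(_ isT).
(* [E] is the even part of the deviator of [N]: off the diagonal only the multiple of [D *m D]
   survives, and a product of two odd matrices couples only indices of equal parity. *)
rewrite invTh; pose E := deviator N + (c / m) *: D.
have -> : deviator N = E - (c / m) *: D by rewrite addrK.
have E0 : contract4 E G D = 0.
  apply: contract4_parity => // i j xij.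
  have ij : (i == j) = false by apply: contraNF xij => /eqP ->.
  have -> : E i j = c ^+ 2 / m * (D *m D) i j by rewrite !mxE ij !mulr0n; ring.
  rewrite mxE big1 ?mulr0// => k _; case xik : (is_xy i == is_xy k).
    by rewrite (oddD _ _ (eqP xik)) mul0r.
  rewrite [D k j]oddD ?mulr0//.
  by case: (is_xy i) (is_xy j) (is_xy k) xij xik => [] [] [].
have trE : (E - (c / m) *: D)^T = E^T - (c / m) *: D^T.
  by rewrite linearB /= linearZ.
rewrite contract4E apply4Z -scalemxAr mxtraceZ trE mulmxBl raddfB /=.
rewrite -scalemxAl mxtraceZ -!contract4E E0 sub0r mulrN opprK.
by rewrite pmulr_rgt0// pmulr_rgt0// divr_gt0.
Qed.

Lemma levi_civita_swap (i j k : 'I_3) : levi_civita R i j k = - levi_civita R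
  j i k.
Proof.
by rewrite /levi_civita; elim/ord3_ind: i; elim/ord3_ind: j;
  elim/ord3_ind: k; rewrite /= ?subr0 ?sub0r ?opprK ?oppr0.
Qed.

(** The skew matrix of [v -> v x b] acting on row vectors from the right, so that the magnetic term
    becomes a matrix product. *)
Definition cross_mx (b : 'rV[R]_3) : 'M[R]_3 :=
  \matrix_(k, j) \sum_(l < 3) levi_civita R j k l * b 0 l.

Lemma mx_crossE A b : mx_cross A b = A *m cross_mx b.
Proof.
apply/matrixP => i j; rewrite !mxE; apply: eq_bigr => k _.
by rewrite mxE mulr_sumr; apply: eq_bigr => l _; rewrite mulrAC mulrC.
Qed.

Lemma cross_mx_antisym b : (cross_mx b)^T = - cross_mx b.
Proof.
apply/matrixP => i j; rewrite !mxE -sumrN; apply: eq_bigr => l _.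
by rewrite levi_civita_swap mulNr.
Qed.

(** Exchanging the two summation indices turns the sum into its negative. *)
Lemma sum_sym_antisym (V S : 'I_3 -> 'I_3 -> R) :
  (forall k l, V k l = - V l k) -> (forall k l, S k l = S l k) ->
  \sum_k \sum_l V k l * S k l = 0.
Proof.
move=> aV sS; set x := LHS; suff : x = - x by lra.
rewrite {1}/x exchange_big /= -sumrN; apply: eq_bigr => k _.
by rewrite -sumrN; apply: eq_bigr => l _; rewrite aV sS mulNr.
Qed.

(** Serves for the Laplacian of the trace equation: [a], [b] and [d] become the second derivatives
    of the advective, pressure work and heat flux terms. *)
Lemma sum_middle_eq0 (c : R) (a b d : 'I_3 -> R) :
  (forall k, c * a k + 2 * b k + d k = 0) ->
  \sum_k a k = 0 -> \sum_k d k = 0 -> \sum_k b k = 0.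
Proof.
move=> E a0 d0; have : \sum_k (c * a k + 2 * b k + d k) = 0 by rewrite big1.
rewrite !big_split /= -!mulr_sumr a0 d0 mulr0 add0r addr0 => ?; lra.
Qed.

Lemma sum_lincomb_eq0 (c d : R) (a b : 'I_3 -> R) :
  \sum_k a k = 0 -> \sum_k b k = 0 -> \sum_k (c * a k + d * b k) = 0.
Proof.
by move=> a0 b0; rewrite big_split /= -!mulr_sumr a0 b0 !mulr0 addr0.
Qed.

Lemma sum_first_eq0 (c d : R) (a b : 'I_3 -> R) : c != 0 ->
  \sum_k (c * a k + d * b k) = 0 -> \sum_k b k = 0 -> \sum_k a k = 0.
Proof.
move=> c0 + b0; rewrite big_split /= -!mulr_sumr b0 mulr0 addr0.
by move=> /eqP; rewrite mulf_eq0 (negbTE c0) => /eqP.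
Qed.

(** The left side is the Leibniz expansion of a second derivative of [\tr (P *m grad_u)] where the
    pressure is isotropic and the velocity gradient antisymmetric. *)
Lemma mxtrace_jet_product (P2 V D W W2 : 'M[R]_3) (c p : R) :
  sym_mx P2 -> V^T = - V ->
  \tr (P2 *m V) + 2 * \tr ((c *: D) *m W) + \tr ((p *: 1%:M) *m W2) =
  2 * c * \tr (D *m W) + p * \tr W2.
Proof.
move=> sP aV; rewrite (mxtrace_sym_antisym sP aV) add0r -!scalemxAl.
by rewrite !mxtraceZ mul1mx mulrA.
Qed.

(** Since [D *m D] is symmetric, its contractions with the antisymmetric [V] and [K] vanish; only
    advection and the derivative [W] of the velocity gradient remain. *)
Lemma balance_contraction (D V W K : 'M[R]_3) (Ds : 'I_3 -> 'M[R]_3)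
    (v : 'I_3 -> R) (t c p kappa : R) : sym_mx D -> V^T = - V -> K^T = - K ->
  \tr (D *m - (t *: (c *: (\sum_l v l *: Ds l) + Sym2 (c *: (D *m V) + p *: W)
    - kappa *: Sym2 (c *: (D *m K))))) =
  - (t * c) * (\sum_l v l * \tr (D *m Ds l)) + - (2 * t * p) * \tr (D *m W).
Proof.
move=> sD aV aK.
have sDD : sym_mx (D *m D) by rewrite /sym_mx trmx_mul sD.
have DV : \tr (D *m (D *m V)) = 0 by rewrite mulmxA mxtrace_sym_antisym.
have DK : \tr (D *m (D *m K)) = 0 by rewrite mulmxA mxtrace_sym_antisym.
have DD : \tr (D *m (\sum_l v l *: Ds l)) = \sum_l v l * \tr (D *m Ds l).
  rewrite mulmx_sumr raddf_sum /=; apply: eq_bigr => l _.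
  by rewrite -scalemxAr mxtraceZ.
rewrite mulmxN raddfN /= -scalemxAr mxtraceZ mulmxBr raddfB /= mulmxDr mxtraceD.
rewrite -!scalemxAr !mxtraceZ !mxtrace_Sym2// mulmxDr mxtraceD -!scalemxAr.
by rewrite !mxtraceZ DV DK DD; ring.
Qed.

End TensorAlgebra.

(** * Entrywise calculus of matrix fields *)

Section MatrixFields.
Variables (R : realType) (U : set 'rV[R]_3).
Hypothesis openU : open U.
Implicit Types (A B : 'rV[R]_3 -> 'M[R]_3) (f : 'rV[R]_3 -> R) (x : 'rV[R]_3).

Definition partial_mx (k : 'I_3) A x : 'M[R]_3 :=
  \matrix_(i, j) partial k (fun y => A y i j) x.

Definition smooth_mx A : Prop := forall i j, smooth_on U (fun y => A y i j).

Lemma partial_mx_at A k x i j :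
  partial_mx k A x i j = partial k (fun y => A y i j) x.
Proof. by rewrite mxE. Qed.

Lemma partial_mxE A k i j :
  (fun y => partial_mx k A y i j) = partial k (fun y => A y i j).
Proof. by apply/funext => y; rewrite mxE. Qed.

Lemma near_eq_partial_mx A B k x : (\forall y \near x, A y = B y) ->
  partial_mx k A x = partial_mx k B x.
Proof.
move=> AB; apply/matrixP => i j; rewrite !mxE; apply: near_eq_partial.
by apply: filterS AB => y ->.
Qed.

Lemma smooth_mx_partial A k : smooth_mx A -> smooth_mx (partial_mx k A).
Proof.
move=> sA i j; under eq_fun do rewrite mxE.
exact: smooth_on_partial (sA i j).
Qed.

Lemma partial_mx_cst (M : 'M[R]_3) k x : partial_mx k (fun=> M) x = 0.
Proof. by apply/matrixP => i j; rewrite !mxE partial_cst. Qed.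

Lemma smooth_mxD A B : smooth_mx A -> smooth_mx B ->
  smooth_mx (fun y => A y + B y).
Proof.
move=> sA sB i j; under eq_fun do rewrite mxE.
exact: smooth_onD (sA i j) (sB i j).
Qed.

Lemma partial_mxD A B k x : smooth_mx A -> smooth_mx B -> U x ->
  partial_mx k (fun y => A y + B y) x = partial_mx k A x + partial_mx k B x.
Proof.
move=> sA sB Ux; apply/matrixP => i j; rewrite !mxE.
by under eq_fun do rewrite mxE; exact: partialD (sA i j) (sB i j) Ux.
Qed.

Lemma smooth_mxZ f A : smooth_on U f -> smooth_mx A ->
  smooth_mx (fun y => f y *: A y).
Proof.
move=> sf sA i j; under eq_fun do rewrite mxE.
exact: smooth_onM sf (sA i j).
Qed.

Lemma partial_mxZ f A k x : smooth_on U f -> smooth_mx A -> U x ->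
  partial_mx k (fun y => f y *: A y) x =
  partial k f x *: A x + f x *: partial_mx k A x.
Proof.
move=> sf sA Ux; apply/matrixP => i j; rewrite !mxE.
by under eq_fun do rewrite mxE; exact: partialM sf (sA i j) Ux.
Qed.

Lemma smooth_mx_tr A : smooth_mx A -> smooth_mx (fun y => (A y)^T).
Proof. by move=> sA i j; under eq_fun do rewrite mxE; exact: sA. Qed.

Lemma partial_mx_tr A k x :
  partial_mx k (fun y => (A y)^T) x = (partial_mx k A x)^T.
Proof.
by apply/matrixP => i j; rewrite !mxE; under eq_fun do rewrite mxE.
Qed.

Lemma smooth_mxM A B : smooth_mx A -> smooth_mx B ->
  smooth_mx (fun y => A y *m B y).
Proof.
move=> sA sB i j; under eq_fun do rewrite mxE.
by apply: smooth_on_sum => // k; exact: smooth_onM.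
Qed.

Lemma partial_mxM A B k x : smooth_mx A -> smooth_mx B -> U x ->
  partial_mx k (fun y => A y *m B y) x =
  partial_mx k A x *m B x + A x *m partial_mx k B x.
Proof.
move=> sA sB Ux; apply/matrixP => i j; rewrite !mxE.
under eq_fun do rewrite mxE.
rewrite (@partial_sum R U _ (fun l y => A y i l * B y l j))//; last first.
  by move=> l; exact: smooth_onM.
rewrite -big_split /=; apply: eq_bigr => l _.
by rewrite (partialM k (sA i l) (sB l j) Ux) !mxE.
Qed.

Lemma smooth_mx_Sym2 A : smooth_mx A -> smooth_mx (fun y => Sym2 (A y)).
Proof. by move=> sA; exact/smooth_mxD/smooth_mx_tr. Qed.

Lemma partial_mx_Sym2 A k x : smooth_mx A -> U x ->
  partial_mx k (fun y => Sym2 (A y)) x = Sym2 (partial_mx k A x).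
Proof.
by move=> sA Ux; rewrite partial_mxD ?partial_mx_tr//; exact: smooth_mx_tr.
Qed.

Lemma smooth_mx_sum (h : 'I_3 -> 'rV[R]_3 -> 'M[R]_3) :
  (forall l, smooth_mx (h l)) -> smooth_mx (fun y => \sum_l h l y).
Proof.
move=> sh i j; under eq_fun do rewrite summxE.
by apply: smooth_on_sum => // l; exact: sh.
Qed.

Lemma partial_mx_sum (h : 'I_3 -> 'rV[R]_3 -> 'M[R]_3) k x :
  (forall l, smooth_mx (h l)) -> U x ->
  partial_mx k (fun y => \sum_l h l y) x = \sum_l partial_mx k (h l) x.
Proof.
move=> sh Ux; apply/matrixP => i j; rewrite mxE summxE.
under eq_fun do rewrite summxE.
rewrite (@partial_sum R U _ (fun l y => h l y i j))//; last by move=> l;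
  exact: sh.
by apply: eq_bigr => l _; rewrite mxE.
Qed.

Lemma smooth_mxtrace A : smooth_mx A -> smooth_on U (fun y => \tr (A y)).
Proof. by move=> sA; apply: smooth_on_sum => // i; exact: sA. Qed.

Lemma partial_mxtrace A k x : smooth_mx A -> U x ->
  partial k (fun y => \tr (A y)) x = \tr (partial_mx k A x).
Proof.
move=> sA Ux; rewrite (@partial_sum R U _ (fun i y => A y i i))//.
by apply: eq_bigr => i _; rewrite mxE.
Qed.

Lemma smooth_mx_deviator A : smooth_mx A -> smooth_mx (fun y => deviator (A y)).
Proof.
move=> sA i j; under eq_fun do rewrite /deviator !mxE -mulrA -mulrN.
apply: smooth_onD => //; apply: smooth_onM (smooth_mxtrace sA) _ => //.
exact: smooth_on_cst.
Qed.

Lemma partial_mx_deviator A k x : smooth_mx A -> U x ->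
  partial_mx k (fun y => deviator (A y)) x = deviator (partial_mx k A x).
Proof.
move=> sA Ux; apply/matrixP => i j; rewrite !mxE.
under eq_fun do rewrite /deviator !mxE -mulrA -mulrN mulrC.
have st := smooth_mxtrace sA.
rewrite (partialD k (sA i j) (smooth_onM openU (smooth_on_cst _ _) st) Ux).
by rewrite (partialZ _ _ st Ux) partial_mxtrace//; ring.
Qed.

(** The derivative of [G] only multiplies [A x], which is zero; applied to the deviator of [T], this
    keeps the gradient of the coefficients out of the argument. *)
Lemma partial_mx_apply4 (G : 'rV[R]_3 -> 'I_3 -> 'I_3 -> 'I_3 -> 'I_3 -> R) A
  k x :
  (forall i j l m, smooth_on U (fun y => G y i j l m)) -> smooth_mx A -> U x ->
  A x = 0 -> 
  partial_mx k (fun y => apply4 (G y) (A y)) x = apply4 (G x) (partial_mx k A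
    x).
Proof.
move=> sG sA Ux A0; apply/matrixP => i j; rewrite !mxE.
under eq_fun do rewrite mxE.
rewrite (@partial_sum R U _ (fun l y => \sum_m G y i j l m * A y l m))//;
  last first.
  by move=> l; apply: smooth_on_sum => // m; exact: smooth_onM.
apply: eq_bigr => l _.
rewrite (@partial_sum R U _ (fun m y => G y i j l m * A y l m))//; last first.
  by move=> m; exact: smooth_onM.
apply: eq_bigr => m _; rewrite (partialM k (sG i j l m) (sA l m) Ux) A0 !mxE.
by rewrite mulr0 add0r.
Qed.

Lemma smooth_mx_apply4 (G : 'rV[R]_3 -> 'I_3 -> 'I_3 -> 'I_3 -> 'I_3 -> R) A :
  (forall i j l m, smooth_on U (fun y => G y i j l m)) -> smooth_mx A ->
  smooth_mx (fun y => apply4 (G y) (A y)).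
Proof.
move=> sG sA i j; under eq_fun do rewrite mxE.
by do 2![apply: smooth_on_sum => // ?]; exact: smooth_onM.
Qed.

Lemma partial2_mxtraceM A B k x : smooth_mx A -> smooth_mx B -> U x ->
  partial k (partial k (fun y => \tr (A y *m B y))) x =
  \tr (partial_mx k (partial_mx k A) x *m B x)
  + 2 * \tr (partial_mx k A x *m partial_mx k B x)
  + \tr (A x *m partial_mx k (partial_mx k B) x).
Proof.
move=> sA sB Ux.
have -> : (fun y => \tr (A y *m B y)) =
    (fun y => \sum_i \sum_j A y i j * B y j i).
  by apply/funext => y; apply: eq_bigr => i _; rewrite mxE.
rewrite (@partial2_sum R U _ (fun i y => \sum_j A y i j * B y j i))//;
  last first.
  by move=> i; apply: smooth_on_sum => // j; exact: smooth_onM.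
rewrite /mxtrace mulr_sumr -!big_split /=; apply: eq_bigr => i _.
rewrite (@partial2_sum R U _ (fun j y => A y i j * B y j i))//; last first.
  by move=> j; exact: smooth_onM.
rewrite !mxE mulr_sumr -!big_split /=; apply: eq_bigr => j _.
apply: etrans (partial2M k openU (sA i j) (sB j i) Ux) _.
congr (_ * _ + 2 * (_ * _) + _ * _).
all: by rewrite partial_mx_at ?partial_mxE.
Qed.

End MatrixFields.

(** * The steady state near the origin *)

Section SteadyState.
Variables (R : realType) (U : set 'rV[R]_3).
Variables (n tau : 'rV[R]_3 -> R) (u B : 'rV[R]_3 -> 'rV[R]_3).
Variables (T Q : 'rV[R]_3 -> 'M[R]_3) (kappa : R).
Variable G : 'rV[R]_3 -> 'I_3 -> 'I_3 -> 'I_3 -> 'I_3 -> R.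
Hypotheses (openU : open U) (U0 : U 0).
Hypothesis adm_n : admissible_on U [::] n.
Hypothesis adm_u : forall i, admissible_on U [:: i] (fun x => u x 0 i).
Hypothesis adm_T : forall i j, admissible_on U [:: i; j] (fun x => T x i j).
Hypothesis smooth_B : forall i, smooth_on U (fun x => B x 0 i).
Hypothesis adm_tau : admissible_on U [::] tau.
Hypothesis adm_G : forall i j k l,
  admissible_on U [:: i; j; k; l] (fun x => G x i j k l).
Hypothesis T_spd : forall x, U x -> spd_mx (T x).
Hypothesis tau_gt0 : forall x, U x -> 0 < tau x.
Hypothesis G_sym0 : forall x, U x -> preserves_sym_traceless (G x).
Hypothesis G_pos : forall x, U x -> entropy_respecting (G x).
Hypothesis n0 : n 0 != 0.
Hypothesis smooth_Q : smooth_mx U Q.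
Hypothesis Q0 : Q 0 = 0.
Hypothesis gradQ0 : forall k, partial_mx k Q 0 = 0.
Hypothesis lapQ0 : forall i j, laplacian (fun x => Q x i j) 0 = 0.

Let K x := cross_mx (B x).
Let P := pressure n T.

Definition grad_u x : 'M[R]_3 :=
  \matrix_(k, j) partial k (fun y => u y 0 j) x.

(** The evolution equation with the closure inserted and multiplied by [tau], so that only products
    of smooth fields need differentiating. [Q] stands for the divergence of the heat flux. *)
Hypothesis balance : \forall x \near (0 : 'rV[R]_3),
  tau x *: (n x *: advect u T x + Sym2 (P x *m grad_u x) + Q x
    - kappa *: Sym2 (P x *m K x)) + n x *: apply4 (G x) (deviator (T x)) = 0.
Hypothesis continuity : \forall x \near (0 : 'rV[R]_3),
  div_vec (fun y => n y *: u y) x = 0.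

Let smooth_n : smooth_on U n. Proof. by have [] := adm_n. Qed.
Let smooth_tau : smooth_on U tau. Proof. by have [] := adm_tau. Qed.
Let smooth_u i : smooth_on U (fun x => u x 0 i).
Proof. by have [] := adm_u i. Qed.
Let smooth_T : smooth_mx U T. Proof. by move=> i j; have [] := adm_T i j. Qed.
Let smooth_G i j k l : smooth_on U (fun x => G x i j k l).
Proof. by have [] := adm_G i j k l. Qed.
Let smooth_V : smooth_mx U grad_u.
Proof.
by move=> i j; under eq_fun do rewrite mxE; exact: smooth_on_partial.
Qed.
Let smooth_K : smooth_mx U K.
Proof.
move=> i j; under eq_fun do rewrite mxE.
by apply: smooth_on_sum => // l; apply: smooth_onM => //; exact: smooth_on_cst.
Qed.
Let smooth_P : smooth_mx U P. Proof. exact: smooth_mxZ. Qed.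

Lemma partial_n0 k : partial k n 0 = 0.
Proof. exact: (even_component_partial0 openU U0 k adm_n). Qed.

Lemma partial_tau0 k : partial k tau 0 = 0.
Proof. exact: (even_component_partial0 openU U0 k adm_tau). Qed.

Lemma u_xy0 l : is_xy l -> u 0 0 l = 0.
Proof. by move=> xl; apply: (odd_component_at0 U0 (adm_u l));
  rewrite /= xl. Qed.

Lemma partial_mx_z x : U x -> partial_mx z_index T x = 0.
Proof.
move=> Ux; apply/matrixP => i j; rewrite !mxE.
by have [_ /(_ _ Ux)] := adm_T i j.
Qed.

Lemma partial_T_even0 k i j : is_xy i = is_xy j -> partial_mx k T 0 i j = 0.
Proof.
move=> xij; rewrite mxE;
  apply: (even_component_partial0 openU U0 k (adm_T i j)).
by rewrite /= xij; case: is_xy.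
Qed.

Lemma sym_T x : U x -> sym_mx (T x). Proof. by move=> /T_spd[]. Qed.

Lemma sym_P x : U x -> sym_mx (P x).
Proof. by move=> Ux; exact/sym_mxZ/sym_T. Qed.

Lemma sym_partial_T k : sym_mx (partial_mx k T 0).
Proof.
rewrite /sym_mx -partial_mx_tr; apply: near_eq_partial_mx.
by apply: filterS (near_open openU U0) => x Ux; exact: sym_T.
Qed.

Lemma mxtrace_partial_T0 k : \tr (partial_mx k T 0) = 0.
Proof. by apply: big1 => i _; exact: partial_T_even0. Qed.

Lemma advectE x : advect u T x = \sum_l u x 0 l *: partial_mx l T x.
Proof.
apply/matrixP => i j; rewrite !mxE summxE; apply: eq_bigr => l _.
by rewrite !mxE.
Qed.

(** Each summand dies: the horizontal velocity is odd, and the vertical velocity multiplies a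
    z-derivative. *)
Lemma advect0 : advect u T 0 = 0.
Proof.
rewrite advectE big1// => l _; case: (boolP (is_xy l)) => [/u_xy0 ->|].
  by rewrite scale0r.
by move=> /negPn/eqP ->; rewrite partial_mx_z// scaler0.
Qed.

(** The summands with an undifferentiated velocity vanish for the reason given for [advect0], now
    using that the z-derivative of [T] is zero on a whole neighborhood. *)
Lemma partial_advect0 k :
  partial_mx k (advect u T) 0 = \sum_l grad_u 0 k l *: partial_mx l T 0.
Proof.
rewrite (_ : advect u T = (fun x => \sum_l u x 0 l *: partial_mx l T x));
  last first.
  by apply/funext => x; exact: advectE.
have sl l : smooth_mx U (partial_mx l T) by exact: smooth_mx_partial.
rewrite (@partial_mx_sum R U openU (fun l x => u x 0 l *: partial_mx l T
  x))//; last first.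
  by move=> l; exact: smooth_mxZ.
apply: eq_bigr => l _; rewrite (partial_mxZ k (smooth_u l) (sl l) U0) mxE.
case: (boolP (is_xy l)) => [/u_xy0 ->|]; first by rewrite scale0r addr0.
move=> /negPn/eqP ->; rewrite (@near_eq_partial_mx R _ (fun=> 0) k 0);
  last first.
  by apply: filterS (near_open openU U0) => x; exact: partial_mx_z.
by rewrite partial_mx_cst scaler0 addr0.
Qed.

Lemma near_divergence : \forall x \near (0 : 'rV[R]_3),
  \sum_l (partial l n x * u x 0 l + n x * partial l (fun y => u y 0 l) x) = 0.
Proof.
apply: filterS2 continuity (near_open openU U0) => x E Ux.
rewrite -[RHS]E; apply: eq_bigr => l _;
  rewrite -(partialM l smooth_n (smooth_u l) Ux).
by congr (partial l _ x); apply/funext => y; rewrite mxE.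
Qed.

(** The density is even, so its gradient vanishes and continuity reduces to [n 0] times the
    divergence of [u]. *)
Lemma mxtrace_grad_u0 : \tr (grad_u 0) = 0.
Proof.
apply: (mulfI n0); rewrite mulr0 -(nbhs_singleton near_divergence) mulr_sumr.
by apply: eq_bigr => l _; rewrite partial_n0 mul0r add0r mxE.
Qed.

Lemma deviator_T0 : deviator (T 0) = 0.
Proof.
have := nbhs_singleton balance; rewrite Q0 advect0 scaler0 add0r addr0 => E.
(* Factoring [T 0] out of both pressure products puts the equation in the form [entropy_equilibrium]
   expects; [X] is traceless because [K 0] is antisymmetric and [u] is divergence-free at the
   origin. *)
pose X := (tau 0 * n 0) *: (kappa *: K 0 - grad_u 0).
apply: (@entropy_equilibrium R (G 0) (T 0) X (n 0)) => //; try by auto.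
  rewrite /X mxtraceZ raddfB /= mxtraceZ (mxtrace_antisym (cross_mx_antisym _)).
  by rewrite mxtrace_grad_u0 mulr0 subr0 mulr0.
have -> : T 0 *m X = tau 0 *: (kappa *: (P 0 *m K 0) - P 0 *m grad_u 0).
  rewrite /X /P /pressure -scalemxAr mulmxBr -scalemxAr -!scalemxAl !scalerBr.
  by rewrite !scalerA; congr (_ *: _ - _); ring.
move/eqP: E; rewrite addrC addr_eq0 => /eqP ->.
by rewrite Sym2Z Sym2B Sym2Z -scalerN opprB.
Qed.

Let p := n 0 * (\tr (T 0) / 3).

Lemma T0E : T 0 = (\tr (T 0) / 3) *: 1%:M.
Proof. exact: deviator0_scalar deviator_T0. Qed.

Lemma P0E : P 0 = p *: 1%:M.
Proof. by rewrite /P /pressure T0E scalerA. Qed.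

Lemma p_neq0 : p != 0.
Proof.
rewrite mulf_neq0//; apply/eqP => t0; have := spd_mx_unit (T_spd U0).
by rewrite T0E t0 scale0r unitr0.
Qed.

(** With an isotropic temperature the relaxation and magnetic terms vanish, leaving [tau 0 * p]
    times the symmetrized velocity gradient. *)
Lemma grad_u0_antisym : (grad_u 0)^T = - grad_u 0.
Proof.
have := nbhs_singleton balance.
rewrite Q0 advect0 scaler0 add0r addr0 deviator_T0 P0E.
(* Zero is written as [0 *: 0] so that homogeneity of [apply4] removes the relaxation term. *)
rewrite -[X in apply4 _ X](scale0r (0 : 'M[R]_3)) apply4Z scale0r scaler0 addr0.
rewrite -!scalemxAl !mul1mx !Sym2Z (Sym2_antisym (cross_mx_antisym _))
  !scaler0 subr0.
move/eqP; rewrite scaler_eq0 gt_eqF ?tau_gt0//= scaler_eq0 (negbTE p_neq0) /=.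
by rewrite /Sym2 addrC addr_eq0 => /eqP.
Qed.

Lemma partial_P0 k : partial_mx k P 0 = n 0 *: partial_mx k T 0.
Proof.
by rewrite (partial_mxZ k smooth_n smooth_T U0) partial_n0 scale0r add0r.
Qed.

Lemma grad_u0_swap k l : grad_u 0 k l = - grad_u 0 l k.
Proof.
by have /matrixP/(_ l k) := grad_u0_antisym; rewrite !mxE.
Qed.

(* What survives is the antisymmetric velocity gradient against the Hessian. *)
Lemma laplacian_advect0 f : smooth_on U f ->
  (forall x, U x -> partial z_index f x = 0) -> (forall l, partial l f 0 = 0) ->
  laplacian (fun x => \sum_l u x 0 l * partial l f x) 0 = 0.
Proof.
move=> sf zf df0; rewrite /laplacian.
have := sum_sym_antisym grad_u0_swap
  (fun k l => @partialC R U f 0 k l openU sf U0).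
(* The factor [2] is that of the cross term in [partial2M]. The outer terms vanish: one contains the
   gradient of [f], the other either a horizontal velocity or a z-derivative. *)
move/(congr1 ( *%R 2)); rewrite mulr0 mulr_sumr => E; apply: etrans E.
apply: eq_bigr => k _.
have sl l : smooth_on U (partial l f) by exact: smooth_on_partial.
rewrite (@partial2_sum R U _ (fun l x => u x 0 l * partial l f x))//;
  last first.
  by move=> l; exact: smooth_onM.
rewrite mulr_sumr; apply: eq_bigr => l _.
apply: etrans (partial2M k openU (smooth_u l) (sl l) U0) _.
rewrite df0 mulr0 add0r mxE.
case: (boolP (is_xy l)) => [/u_xy0 ->|]; first by rewrite mul0r addr0.
move=> /negPn/eqP ->; rewrite (@near_eq_partial2 R (partial z_index f) (fun=>
  0) 0 k k).
  by rewrite !partial_cst mulr0 addr0.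
by apply: filterS (near_open openU U0) => x; exact: zf.
Qed.

(** In the Laplacian of the continuity equation, [laplacian_advect0] removes the part where [u] acts
    on [n]; in the rest, the zero gradient of [n] and zero divergence of [u] leave only [n 0] times
    this sum. *)
Lemma laplacian_div_u0 : \sum_k \tr (partial_mx k (partial_mx k grad_u) 0) = 0.
Proof.
have zn x : U x -> partial z_index n x = 0.
  by have [_ zn _] := adm_n; exact: zn.
have := laplacian_advect0 smooth_n zn partial_n0; rewrite /laplacian => L1.
(* Adding the vanishing sum [L1] makes each term in [k] a second derivative of the expanded
   continuity equation. *)
apply: (mulfI n0); rewrite mulr0 -[LHS]add0r -[X in X + _ = _]L1 mulr_sumr.
rewrite -big_split /=; apply: big1 => k _.
have sV := smooth_mxtrace openU smooth_V.
have sA : smooth_on U (fun x => \sum_l u x 0 l * partial l n x).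
  apply: smooth_on_sum => // l; apply: smooth_onM => //.
  exact: smooth_on_partial.
have := @near_eq_partial2 R (fun x => \sum_l u x 0 l * partial l n x
  + n x * \tr (grad_u x)) (fun=> 0) 0 k k.
rewrite !partial_cst (partial2D k k openU sA (smooth_onM openU smooth_n sV) U0).
rewrite (partial2M k openU smooth_n sV U0) mxtrace_grad_u0 partial_n0.
rewrite mulr0 mul0r mulr0 !add0r.
have -> : partial k (partial k (fun x => \tr (grad_u x))) 0 =
    \tr (partial_mx k (partial_mx k grad_u) 0).
  rewrite -(partial_mxtrace openU k (smooth_mx_partial k smooth_V) U0).
  apply: near_eq_partial; apply: filterS (near_open openU U0) => x Ux.
  exact: (partial_mxtrace openU k smooth_V Ux).
apply; apply: filterS near_divergence => x E; rewrite -[RHS]E.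
rewrite /mxtrace mulr_sumr -big_split /=.
by apply: eq_bigr => l _; rewrite mxE mulrC.
Qed.

(** The trace removes relaxation, as [G] preserves tracelessness, and the magnetic term, a symmetric
    matrix against an antisymmetric one; the positive factor [tau x] then cancels. *)
Lemma near_trace_balance : \forall x \near (0 : 'rV[R]_3),
  n x * (\sum_l u x 0 l * partial l (fun y => \tr (T y)) x)
  + 2 * \tr (P x *m grad_u x) + \tr (Q x) = 0.
Proof.
apply: filterS2 balance (near_open openU U0) => x E Ux.
have [_ trY] := G_sym0 Ux (sym_mx_deviator (sym_T Ux)) (mxtrace_deviator (T x)).
have trS X : \tr (Sym2 X) = 2 * \tr X.
  by rewrite mxtraceD mxtrace_tr -mulr2n mulr_natl.
have := congr1 (@mxtrace R 3) E.
rewrite mxtraceD !mxtraceZ trY mulr0 addr0 raddfB /= !mxtraceD !mxtraceZ !trS.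
rewrite (mxtrace_sym_antisym (sym_P Ux) (cross_mx_antisym _)) !mulr0 subr0
  mxtrace0.
move/eqP; rewrite mulf_eq0 gt_eqF ?tau_gt0//= => /eqP E2; rewrite -[RHS]E2.
congr (_ * _ + _ + _); last by rewrite mxtrace_tr -mulr2n mulr_natl.
rewrite advectE raddf_sum /=; apply: eq_bigr => l _.
by rewrite mxtraceZ (partial_mxtrace openU l smooth_T Ux).
Qed.

(** In the Laplacian of the trace equation, advection drops by [laplacian_advect0] for the trace of
    [T], and the heat flux by assumption. The pressure work leaves this sum plus a multiple of
    [laplacian_div_u0]. *)
Lemma sum_mxtrace_DW : \sum_k \tr (partial_mx k T 0 *m partial_mx k grad_u 0)
  = 0.
Proof.
have st := smooth_mxtrace openU smooth_T.
have dt l : partial l (fun y => \tr (T y)) 0 = 0.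
  by rewrite (partial_mxtrace openU l smooth_T U0) mxtrace_partial_T0.
have zt x : U x -> partial z_index (fun y => \tr (T y)) x = 0.
  by move=> Ux; rewrite (partial_mxtrace openU _ smooth_T Ux) partial_mx_z//
    mxtrace0.
have L1 := laplacian_advect0 st zt dt.
have L2 : \sum_k partial k (partial k (fun x => \tr (Q x))) 0 = 0.
  have : \sum_i laplacian (fun x => Q x i i) 0 = 0.
    by apply: big1 => i _; exact: lapQ0.
  rewrite /laplacian exchange_big /= => S0; rewrite -[RHS]S0.
  apply: eq_bigr => k _.
  by rewrite (@partial2_sum R U _ (fun i x => Q x i i)).
set a := fun x => _ in L1.
have sa : smooth_on U a.
  apply: smooth_on_sum => // l; apply: smooth_onM => //.
  exact: smooth_on_partial.
(* This value removes the second derivatives of [n], on which parity gives no information. *)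
have a0 : a 0 = 0.
  by rewrite /a big1// => l _; rewrite dt mulr0.
have sPV : smooth_on U (fun x => \tr (P x *m grad_u x)).
  exact/smooth_mxtrace/smooth_mxM.
have sna := smooth_onM openU smooth_n sa.
have s2PV := smooth_onM openU (smooth_on_cst U 2) sPV.
have sQ := smooth_mxtrace openU smooth_Q.
have E k : n 0 * partial k (partial k a) 0 +
    2 * partial k (partial k (fun x => \tr (P x *m grad_u x))) 0 +
    partial k (partial k (fun x => \tr (Q x))) 0 = 0.
  have := @near_eq_partial2 R _ (fun=> 0) 0 k k near_trace_balance.
  rewrite !partial_cst (partial2D k k openU (smooth_onD openU sna s2PV) sQ U0).
  rewrite (partial2D k k openU sna s2PV U0) (partial2M k openU smooth_n sa U0).
  rewrite (partial2M k openU (smooth_on_cst U 2) sPV U0) !partial_cst a0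
    partial_n0.
  by rewrite !(mul0r, mulr0, add0r).
have L3 := sum_middle_eq0 E L1 L2.
have E2 k : partial k (partial k (fun x => \tr (P x *m grad_u x))) 0 =
    2 * n 0 * \tr (partial_mx k T 0 *m partial_mx k grad_u 0)
    + p * \tr (partial_mx k (partial_mx k grad_u) 0).
  rewrite (partial2_mxtraceM openU k smooth_P smooth_V U0) partial_P0 P0E.
  apply: mxtrace_jet_product grad_u0_antisym.
  (* Symmetry of [P] holds near the origin, hence passes to first derivatives near it and to second
     derivatives at it. *)
  rewrite /sym_mx -!partial_mx_tr; apply: near_eq_partial_mx.
  have := nbhs_interior (near_open openU U0); apply: filterS => x nUx.
  rewrite -partial_mx_tr; apply: near_eq_partial_mx.
  by apply: filterS nUx => y Uy; exact: sym_P.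
have c0 : 2 * n 0 != 0 by rewrite mulf_neq0// pnatr_eq0.
exact: sum_first_eq0 c0 (etrans (esym (eq_bigr _ (fun k _ => E2 k))) L3)
  laplacian_div_u0.
Qed.

(** * First derivatives of the balance and vanishing of the temperature gradient *)

Let D k := partial_mx k T 0.
Let V := grad_u 0.
Let W k := partial_mx k grad_u 0.
Let K' k := partial_mx k K 0.

(** Antisymmetry at every point passes to derivatives; this is what eliminates the gradient of the
    magnetic field from [partial_balance]. *)
Lemma K'_antisym k : (K' k)^T = - K' k.
Proof.
apply/matrixP => i j; rewrite !mxE -mulN1r.
rewrite -(partialZ (-1) k (smooth_K i j) U0); apply: near_eq_partial.
apply: filterE => x; rewrite mulN1r.
by have /matrixP/(_ i j) := cross_mx_antisym (B x); rewrite [LHS]mxE [RHS]mxE.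
Qed.

(** Parity kills the gradients of [tau] and [n], the derivative of [G] meets a zero deviator, and
    the derivative of [K] meets the isotropic [P 0], giving a symmetrized antisymmetric matrix. *)
Lemma partial_balance k :
  tau 0 *: (n 0 *: (\sum_l V k l *: D l) + Sym2 (n 0 *: (D k *m V) + p *: W k)
    - kappa *: Sym2 (n 0 *: (D k *m K 0))) + n 0 *: apply4 (G 0) (D k) = 0.
Proof.
have sadv : smooth_mx U (advect u T).
  rewrite (_ : advect u T = (fun x => \sum_l u x 0 l *: partial_mx l T x));
    last first.
    by apply/funext => x; exact: advectE.
  apply: smooth_mx_sum => // l; apply: smooth_mxZ => //.
  exact: smooth_mx_partial.
have s1 := smooth_mxZ openU smooth_n sadv.
have sPV := smooth_mxM openU smooth_P smooth_V.
have s2 := smooth_mx_Sym2 openU sPV.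
have s12 := smooth_mxD openU s1 s2.
have s3 := smooth_mxD openU s12 smooth_Q.
have sPK := smooth_mxM openU smooth_P smooth_K.
(* The subtraction is read as adding a multiple by the constant field [- kappa], so the sum and
   product rules suffice. *)
have s4 := smooth_mxZ openU (smooth_on_cst U (- kappa)) (smooth_mx_Sym2 openU
  sPK).
have s5 := smooth_mxD openU s3 s4.
have sd := smooth_mx_deviator openU smooth_T.
have sY := smooth_mx_apply4 openU smooth_G sd.
have s6 := smooth_mxZ openU smooth_tau s5.
have s7 := smooth_mxZ openU smooth_n sY.
have E5 : partial_mx k (fun x => n x *: advect u T x + Sym2 (P x *m grad_u x)
      + Q x + - kappa *: Sym2 (P x *m K x)) 0 =
    n 0 *: (\sum_l V k l *: D l) + Sym2 (n 0 *: (D k *m V) + p *: W k)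
    - kappa *: Sym2 (n 0 *: (D k *m K 0)).
  rewrite (partial_mxD k s3 s4 U0) (partial_mxD k s12 smooth_Q U0) gradQ0 addr0.
  rewrite (partial_mxD k s1 s2 U0); congr (_ + _ + _).
  - by rewrite (partial_mxZ k smooth_n sadv U0) partial_n0 scale0r add0r
    partial_advect0.
  - rewrite (partial_mx_Sym2 k sPV U0) (partial_mxM openU k smooth_P smooth_V
    U0).
    by rewrite partial_P0 P0E -!scalemxAl mul1mx.
  - rewrite (partial_mxZ k (smooth_on_cst U (- kappa)) (smooth_mx_Sym2 openU
    sPK) U0).
    rewrite partial_cst scale0r add0r scaleNr; congr (- (_ *: _)).
    rewrite (partial_mx_Sym2 k sPK U0) (partial_mxM openU k smooth_P smooth_K
      U0).
    rewrite partial_P0 P0E -!scalemxAl mul1mx Sym2D [Sym2 (p *: _)]Sym2Z.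
    by rewrite (Sym2_antisym (K'_antisym k)) scaler0 addr0.
have EY : partial_mx k (fun x => apply4 (G x) (deviator (T x))) 0 = apply4 (G
  0) (D k).
  rewrite (partial_mx_apply4 openU k smooth_G sd U0 deviator_T0).
  rewrite (partial_mx_deviator openU k smooth_T U0) /deviator
    mxtrace_partial_T0.
  by rewrite mul0r scale0r subr0.
rewrite -E5 -EY -(partial_mx_cst 0 k 0).
have <- := near_eq_partial_mx k balance.
under [in RHS]eq_fun do rewrite -scaleNr.
rewrite (partial_mxD k s6 s7 U0) (partial_mxZ k smooth_tau s5 U0).
rewrite (partial_mxZ k smooth_n sY U0) partial_tau0 partial_n0.
by rewrite !scale0r !add0r.
Qed.

(** After summation over [k], the advective part pairs the antisymmetric [V k l] with the symmetric
    [\tr (D k *m D l)], and the other part is [sum_mxtrace_DW]. *)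
Lemma sum_contract4_D : \sum_k contract4 (D k) (G 0) (D k) = 0.
Proof.
apply: (mulfI n0); rewrite mulr0 mulr_sumr.
have E k : n 0 * contract4 (D k) (G 0) (D k) =
    - (tau 0 * n 0) * (\sum_l V k l * \tr (D k *m D l))
    + - (2 * tau 0 * p) * \tr (D k *m W k).
  rewrite contract4E sym_partial_T -mxtraceZ scalemxAr.
  have /eqP := partial_balance k; rewrite addrC addr_eq0 => /eqP ->.
  exact: balance_contraction (sym_partial_T k) grad_u0_antisym
    (cross_mx_antisym _).
have S := sum_sym_antisym grad_u0_swap (fun k l => mxtrace_mulC (D k) (D l)).
apply: etrans (eq_bigr _ (fun k _ => E k)) _.
exact: sum_lincomb_eq0 S sum_mxtrace_DW.
Qed.

(** By [contract4_odd_gt0] the terms of [sum_contract4_D] are nonnegative, and a nonzero [D k] would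
    make the sum positive. *)
Lemma partial_T0 k : partial_mx k T 0 = 0.
Proof.
(* Components of [G] with an odd number of horizontal indices are odd functions, so they vanish at
   the origin. *)
have evG i j l m : is_xy i (+) is_xy j (+) is_xy l (+) is_xy m -> G 0 i j l m
  = 0.
  move=> x4; apply: (odd_component_at0 U0 (adm_G i j l m)); move: x4 => /=.
  by case: (is_xy i) (is_xy j) (is_xy l) (is_xy m) => [] [] [] [].
have gt0 l : D l != 0 -> 0 < contract4 (D l) (G 0) (D l).
  apply: contract4_odd_gt0 (G_pos U0) (sym_partial_T l) _ evG.
  by move=> i j; exact: partial_T_even0.
have ge0 l : 0 <= contract4 (D l) (G 0) (D l).
  have [D0|/gt0/ltW//] := eqVneq (D l) 0.
  by rewrite D0 contract4E trmx0 mul0mx mxtrace0.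
apply/eqP/negPn/negP => /gt0; apply/negP; rewrite -leNgt.
by rewrite -sum_contract4_D (bigD1 k)//= lerDl sumr_ge0.
Qed.

Lemma div_pressure0 : div_mx P 0 = 0.
Proof.
apply/rowP => j; rewrite !mxE big1// => i _.
by rewrite -(partial_mx_at P i 0 i j) partial_P0 partial_T0 scaler0 mxE.
Qed.

End SteadyState.

(** * Reduction of the moment equations and closure to [balance] *)

Theorem corollary2 (R : realType) (U : set 'rV[R]_3)
  (n : 'rV[R]_3 -> R) (u : 'rV[R]_3 -> 'rV[R]_3) (T : 'rV[R]_3 -> 'M[R]_3)
  (q : 'rV[R]_3 -> 'I_3 -> 'I_3 -> 'I_3 -> R) (B : 'rV[R]_3 -> 'rV[R]_3)
  (tau : 'rV[R]_3 -> R) (G : 'rV[R]_3 -> 'I_3 -> 'I_3 -> 'I_3 -> 'I_3 -> R)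
  (Rt : 'rV[R]_3 -> 'M[R]_3) (kappa : R)
  (openU : open U) (U0 : U 0)
  (adm_n : admissible_on U [::] n)
  (adm_u : forall i, admissible_on U [:: i] (fun x => u x 0 i))
  (adm_T : forall i j, admissible_on U [:: i; j] (fun x => T x i j))
  (adm_q : forall i j k, admissible_on U [:: i; j; k] (fun x => q x i j k))
  (adm_B : forall i, admissible_on U [:: i] (fun x => B x 0 i))
  (adm_tau : admissible_on U [::] tau)
  (adm_G : forall i j k l,
    admissible_on U [:: i; j; k; l] (fun x => G x i j k l))
  (T_spd : forall x, U x -> spd_mx (T x))
  (q_sym : forall x, U x -> sym_tensor3 (q x))
  (tau_gt0 : forall x, U x -> 0 < tau x)
  (G_sym0 : forall x, U x -> preserves_sym_traceless (G x))
  (G_gyro : forall x, U x -> gyrotropic (B x) (G x))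
  (G_pos : forall x, U x -> entropy_respecting (G x))
  (evolution : \forall x \near (0 : 'rV[R]_3),
    n x *: advect u T x + Sym2 (mx_dot_grad (pressure n T) u x)
      + div_tensor3 q x
    = kappa *: Sym2 (mx_cross (pressure n T x) (B x)) + Rt x)
  (continuity : \forall x \near (0 : 'rV[R]_3),
    div_vec (fun y => n y *: u y) x = 0)
  (closure : \forall x \near (0 : 'rV[R]_3),
    (n x)^-1 *: Rt x = - ((tau x)^-1 *: apply4 (G x) (deviator (T x))))
  (n_neq0 : n 0 != 0)
  (divq0 : div_tensor3 q 0 = 0)
  (grad_divq0 : forall i j k, partial k (fun x => div_tensor3 q x i j) 0 = 0)
  (lap_divq0 : forall i j, laplacian (fun x => div_tensor3 q x i j) 0 = 0) :
  div_mx (pressure n T) 0 = 0.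
Proof.
have smooth_q i j k : smooth_on U (fun x => q x i j k) by have [] := adm_q i j
  k.
have smooth_divq : smooth_mx U (div_tensor3 q).
  move=> i j; under eq_fun do rewrite mxE.
  by apply: smooth_on_sum => // k; exact: smooth_on_partial.
have smooth_B i : smooth_on U (fun x => B x 0 i) by have [] := adm_B i.
have smooth_n : smooth_on U n by have [] := adm_n.
have grad_divq k : partial_mx k (div_tensor3 q) 0 = 0.
  by apply/matrixP => i j; rewrite !mxE; exact: grad_divq0.
(* Since [0^-1 = 0], the closure determines [Rt x] only where [n x] is nonzero, which continuity
   ensures near the origin. *)
have n_near : \forall x \near (0 : 'rV[R]_3), n x != 0.
  exact: cvgr_neq0 (smooth_on_continuous smooth_n U0) n_neq0.
apply: (div_pressure0 (kappa := kappa) openU U0 adm_n adm_u adm_T smooth_B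
  adm_tau adm_G T_spd
  tau_gt0 G_sym0 G_pos n_neq0 smooth_divq divq0 grad_divq lap_divq0 _
    continuity).
have Un : \forall x \near (0 : 'rV[R]_3), U x /\ n x != 0.
  by apply: filterI => //; exact: near_open.
apply: filterS3 evolution closure Un => x E C [Ux nx].
have {C}RtE : tau x *: Rt x = - (n x *: apply4 (G x) (deviator (T x))).
  have tx : tau x != 0 by rewrite gt_eqF ?tau_gt0.
  rewrite -[Rt x](scalerKV nx) C !scalerN !scalerA; congr (- (_ *: _)).
  by rewrite mulrAC mulfV// mul1r.
have gradE : mx_dot_grad (pressure n T) u x = pressure n T x *m grad_u u x.
  apply/matrixP => i j; rewrite !mxE; apply: eq_bigr => k _.
  by rewrite [grad_u _ _ _ _]mxE.
by rewrite -gradE E mx_crossE [X in X - _]addrC addrK RtE addNr.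
Qed.
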